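(* Let $w_1,w_2,w_3$ be positive integers, $n\ge 0$ an integer, and $y_1,y_2,y_3\in\mathbb{Z}_p$. Then \begin{align*} &\sum_{k+l+m=n}\binom{n}{k,l,m}B_{k,q^{w_2w_3}}(w_1y_1)B_{l,q^{w_1w_3}}(w_2y_2)B_{m,q^{w_1w_2}}(w_3y_3)\,w_1^{l+m}w_2^{k+m}w_3^{k+l}\\ &=\sum_{k+l+m=n}\binom{n}{k,l,m}B_{k,q^{w_2w_3}}(w_1y_1)B_{l,q^{w_1w_2}}(w_3y_2)B_{m,q^{w_1w_3}}(w_2y_3)\,w_1^{l+m}w_3^{k+m}w_2^{k+l}\\ &=\sum_{k+l+m=n}\binom{n}{k,l,m}B_{k,q^{w_1w_3}}(w_2y_1)B_{l,q^{w_2w_3}}(w_1y_2)B_{m,q^{w_1w_2}}(w_3y_3)\,w_2^{l+m}w_1^{k+m}w_3^{k+l}\\ &=\sum_{k+l+m=n}\binom{n}{k,l,m}B_{k,q^{w_1w_3}}(w_2y_1)B_{l,q^{w_1w_2}}(w_3y_2)B_{m,q^{w_2w_3}}(w_1y_3)\,w_2^{l+m}w_3^{k+m}w_1^{k+l}\\ &=\sum_{k+l+m=n}\binom{n}{k,l,m}B_{k,q^{w_1w_2}}(w_3y_1)B_{l,q^{w_2w_3}}(w_1y_2)B_{m,q^{w_1w_3}}(w_2y_3)\,w_3^{l+m}w_1^{k+m}w_2^{k+l}\\ &=\sum_{k+l+m=n}\binom{n}{k,l,m}B_{k,q^{w_1w_2}}(w_3y_1)B_{l,q^{w_1w_3}}(w_2y_2)B_{m,q^{w_2w_3}}(w_1y_3)\,w_3^{l+m}w_2^{k+m}w_1^{k+l}.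 \end{align*}
   Context: Let $p$ be a prime, $\mathbb{C}_p$ the completion of an algebraic closure of $\mathbb{Q}_p$, and $|\cdot|_p$ the absolute value on $\mathbb{C}_p$ with $|p|_p=1/p$. Fix $q\in\mathbb{C}_p$ with $q\neq 1$ and $|q-1|_p<p^{-1/(p-1)}$; for every positive integer $w$, $Q=q^w$ also satisfies $Q\neq1$, $|Q-1|_p<p^{-1/(p-1)}$. For such $Q$, the $Q$-Bernoulli numbers $B_{n,Q}$ are defined by the generating function $\frac{\log Q+t}{Qe^t-1}=\sum_{n\ge0}B_{n,Q}\frac{t^n}{n!}$ ($\log$ the $p$-adic logarithm), and the $Q$-Bernoulli polynomials by $\frac{\log Q+t}{Qe^t-1}e^{xt}=\sum_{n\ge0}B_{n,Q}(x)\frac{t^n}{n!}$, i.e. $B_{n,Q}(x)=\sum_{j=0}^n\binom{n}{j}B_{j,Q}x^{n-j}$. The sum $\sum_{k+l+m=n}$ runs over all nonnegative integers $k,l,m$ with $k+l+m=n$, and $\binom{n}{k,l,m}=\frac{n!}{k!\,l!\,m!}$. *)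

(* Defs.v *)
From HB Require Import structures.
From mathcomp Require Export all_boot all_order all_algebra.
From mathcomp Require Export boolp classical_sets reals topology normedtype.
From mathcomp Require Export sequences exp.
From mathcomp Require Import ring.

Set Implicit Arguments.
Unset Strict Implicit.
Unset Printing Implicit Defensive.

Import Order.TTheory GRing.Theory Num.Theory.
Import numFieldNormedType.Exports.

Local Open Scope classical_set_scope.
Local Open Scope ring_scope.

Section ValuedFields.
Variable R : realType.

Record absolute_value (K : fieldType) (v : K -> R) : Prop := AbsoluteValue {
  absv_ge0 : forall x, 0 <= v x;
  absv_eq0 : forall x, v x = 0 <-> x = 0;
  absvM : forall x y, v (x * y) = v x * v y;
  absvD_max : forall x y, v (x + y) <= Num.max (v x) (v y) }.

Definition absv_cvg (K : fieldType) (v : K -> R) (u : nat -> K) (l : K) : Prop :=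
  v (u n - l) @[n --> \oo] --> (0 : R).

Definition absv_cauchy (K : fieldType) (v : K -> R) (u : nat -> K) : Prop :=
  forall e : R, 0 < e ->
    exists N, forall m n, (N <= m)%N -> (N <= n)%N -> v (u m - u n) < e.

Record is_completion (F K : fieldType) (vF : F -> R) (vK : K -> R)
    (i : {rmorphism F -> K}) : Prop := IsCompletion {
  completion_abs : absolute_value vK;
  completion_isometry : forall x, vK (i x) = vF x;
  completion_dense : forall (x : K) (e : R), 0 < e -> exists a, vK (x - i a) < e;
  completion_complete :
    forall u, absv_cauchy vK u -> exists l, absv_cvg vK u l }.

Definition padic_abs_rat (p : nat) (x : rat) : R :=
  if x == 0 then 0
  else p%:R ^+ logn p `|denq x|%N / p%:R ^+ logn p `|numq x|%N.

End ValuedFields.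

(* The library has neither Q_p nor C_p.  A value of this type is a realization
   of Q -> Q_p -> Qpbar -> C_p, with Q_p a completion of Q for the p-adic
   absolute value, Qpbar an algebraic closure of Q_p with an absolute value
   extending that of Q_p, and C_p a completion of Qpbar.  For p prime these
   data are unique up to isometric isomorphism. *)
Record padic_tower (R : realType) (p : nat) := PadicTower {
  Qp : fieldType;
  Qp_abs : Qp -> R;
  Qp_of_rat : {rmorphism rat -> Qp};
  Qp_completion : is_completion (@padic_abs_rat R p) Qp_abs Qp_of_rat;
  Qpbar : closedFieldType;
  Qpbar_abs : Qpbar -> R;
  Qpbar_of_Qp : {rmorphism Qp -> Qpbar};
  Qpbar_algebraic : forall x : Qpbar, algebraicOver Qpbar_of_Qp x;
  Qpbar_absP : absolute_value Qpbar_abs;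
  Qpbar_abs_Qp : forall x : Qp, Qpbar_abs (Qpbar_of_Qp x) = Qp_abs x;
  Cp : fieldType;
  Cp_abs : Cp -> R;
  Cp_of_Qpbar : {rmorphism Qpbar -> Cp};
  Cp_completion : is_completion Qpbar_abs Cp_abs Cp_of_Qpbar }.

Arguments Qp_abs {R p} _ _.
Arguments Qpbar_abs {R p} _ _.
Arguments Cp_abs {R p} _ _.

Section Embeddings.
Variables (R : realType) (p : nat) (T : padic_tower R p).

Definition padic_integers : set (Qp T) := [set x | Qp_abs T x <= 1].

Definition Cp_of_Qp (x : Qp T) : Cp T := Cp_of_Qpbar T (Qpbar_of_Qp T x).

End Embeddings.

Lemma Cp_abs_p (R : realType) (p : nat) (T : padic_tower R p) :
  prime p -> Cp_abs T p%:R = p%:R^-1.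
Proof.
move=> p_pr; have -> : p%:R = Cp_of_Qp (Qp_of_rat T p%:R).
  by rewrite /Cp_of_Qp !rmorph_nat.
rewrite /Cp_of_Qp (completion_isometry (Cp_completion T)) Qpbar_abs_Qp.
rewrite (completion_isometry (Qp_completion T)) /padic_abs_rat pnatr_eq0.
have p_gt0 := prime_gt0 p_pr; rewrite gtn_eqF// [in denq _]pmulrn [in numq _]pmulrn.
rewrite denq_int numq_int /= logn1 expr0 mul1r.
by rewrite lognE p_pr p_gt0 dvdnn divnn p_gt0 logn1 expr1.
Qed.

(* log Q = sum_(k >= 1) (-1)^(k+1) (Q - 1)^k / k, with junk value 0 when the
   series diverges (in C_p, exactly when |Q - 1| >= 1). *)
Definition padic_log (R : realType) (K : fieldType) (v : K -> R) (Q : K) : K :=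
  xget 0 [set l | absv_cvg v
    (fun n => \sum_(1 <= k < n) (-1) ^+ k.+1 * (Q - 1) ^+ k / k%:R) l].

(* The formal power series sum_n (f n) t^n is the function f : nat -> K. *)
Section FormalPowerSeries.
Variable K : fieldType.
Implicit Types f g : nat -> K.

Definition fps_mul f g : nat -> K :=
  fun n => \sum_(i < n.+1) f i * g (n - i)%N.

Fixpoint fps_div_coefs f g (n : nat) : seq K :=
  if n is m.+1 then
    let s := fps_div_coefs f g m in
    rcons s ((f m - \sum_(i < m) s`_i * g (m - i)%N) / g 0%N)
  else [::].

(* The quotient f / g, meaningful when g 0 != 0: see fps_divK. *)
Definition fps_div f g : nat -> K := fun n => (fps_div_coefs f g n.+1)`_n.

Definition fps_exp (x : K) : nat -> K := fun n => x ^+ n / n`!%:R.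

Lemma size_fps_div_coefs f g n : size (fps_div_coefs f g n) = n.
Proof. by elim: n => //= n IHn; rewrite size_rcons IHn. Qed.

Lemma nth_fps_div_coefs f g n i :
  (i < n)%N -> (fps_div_coefs f g n)`_i = fps_div f g i.
Proof.
elim: n => // n IHn; rewrite ltnS leq_eqVlt => /orP[/eqP -> //|lt_in].
by rewrite /= nth_rcons size_fps_div_coefs lt_in IHn.
Qed.

Lemma fps_divE f g n :
  fps_div f g n = (f n - \sum_(i < n) fps_div f g i * g (n - i)%N) / g 0%N.
Proof.
rewrite {1}/fps_div /= nth_rcons size_fps_div_coefs ltnn eqxx.
by under eq_bigr => i _ do rewrite nth_fps_div_coefs//.
Qed.

Lemma fps_divK f g : g 0%N != 0 -> fps_mul (fps_div f g) g = f.
Proof.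
move=> g0; apply/funext => n; rewrite /fps_mul big_ord_recr /= subnn.
by rewrite [X in _ + X * _]fps_divE divfK// addrC subrK.
Qed.

End FormalPowerSeries.

Section QBernoulli.
Variables (R : realType) (K : fieldType) (v : K -> R).

(* (log Q + t) / (Q e^t - 1) *)
Definition qBernoulli_series (Q : K) : nat -> K :=
  fps_div
    (fun n => if n is 0 then padic_log v Q else (n == 1%N)%:R)
    (fun n => Q * fps_exp 1 n - (n == 0%N)%:R).

Definition qBernoulli_number (Q : K) (n : nat) : K :=
  n`!%:R * qBernoulli_series Q n.

Definition qBernoulli_poly (Q : K) (n : nat) : {poly K} :=
  \sum_(j < n.+1) ('C(n, j)%:R * qBernoulli_number Q j) *: 'X^(n - j).

Lemma qBernoulli_poly_series (Q x : K) (n : nat) :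
    (forall m, m.+1%:R != 0 :> K) ->
  (qBernoulli_poly Q n).[x] / n`!%:R =
  fps_mul (qBernoulli_series Q) (fps_exp x) n.
Proof.
move=> char0; have fact0 m : m`!%:R != 0 :> K.
  by rewrite -(prednK (fact_gt0 m)).
rewrite /qBernoulli_poly horner_sum mulr_suml; apply: eq_bigr => j _.
have le_jn : (j <= n)%N by rewrite -ltnS.
rewrite /fps_exp /qBernoulli_number hornerZ hornerXn.
rewrite -(bin_fact le_jn) 2!natrM.
have bin0 : 'C(n, j)%:R != 0 :> K by rewrite -(prednK (_ : 0 < 'C(n, j))%N) ?bin_gt0.
by field; rewrite !fact0 bin0.
Qed.

End QBernoulli.

Definition trinomial_sum (K : fieldType) (n : nat) (F : nat -> nat -> nat -> K) : K :=
  \sum_(k < n.+1) \sum_(l < n.+1) \sum_(m < n.+1 | (k + l + m == n)%N)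
    n`!%:R / (k`! * l`! * m`!)%:R * F k l m.

(* Main.v *)
(** After division by [n!], each of the six sums is the coefficient of [t^n] in
    a product of three series [G_c(t) e^{c x t}], where
    [G_c(t) = (log q^c + c t) / (q^c e^{c t} - 1)] and [c] runs through
    [w2 w3], [w1 w3], [w1 w2].  As [c x] is always [w1 w2 w3] times one of the
    [y_i], the exponentials multiply to [e^{w1 w2 w3 (y1 + y2 + y3) t}], so all
    six products agree by commutativity. *)

Require Import Defs.
From mathcomp Require Import all_boot all_order all_algebra.
From mathcomp Require Import classical_sets reals exp.
From mathcomp Require Import ring zify.

Set Implicit Arguments.
Unset Strict Implicit.
Unset Printing Implicit Defensive.

Import Order.TTheory GRing.Theory Num.Theory.

Local Open Scope classical_set_scope.
Local Open Scope ring_scope.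

Section FormalPowerSeriesTheory.
Variable K : fieldType.
Implicit Types f g h : nat -> K.

(** The substitution of [c * t] for [t]. *)
Definition fps_scale (c : K) f : nat -> K := fun n => c ^+ n * f n.

(** Coefficients up to degree [n] see only the truncations of [f] and [g], so ring laws of
    [{poly K}] carry over to series coefficientwise. *)
Lemma coef_fps_mul f g n m : (m <= n)%N ->
  (\poly_(i < n.+1) f i * \poly_(i < n.+1) g i)`_m = fps_mul f g m.
Proof.
move=> le_mn; rewrite coefM; apply: eq_bigr => -[i /= lt_im] _.
by rewrite !coef_poly !ifT //; lia.
Qed.

Lemma fps_mulC f g : fps_mul f g = fps_mul g f.
Proof. by apply/funext => n; rewrite -!(coef_fps_mul _ _ (leqnn n)) mulrC. Qed.

Lemma fps_mulA f g h : fps_mul f (fps_mul g h) = fps_mul (fps_mul f g) h.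
Proof.
apply/funext => n; pose T u := \poly_(i < n.+1) (u i : K).
transitivity ((T f * (T g * T h))`_n).
  rewrite coefM; apply: eq_bigr => i _.
  by rewrite coef_poly ltn_ord coef_fps_mul ?leq_subr.
rewrite mulrA coefM; apply: eq_bigr => i _.
by rewrite coef_poly ltnS leq_subr coef_fps_mul // -ltnS.
Qed.

Lemma fps_mulAC f g h : fps_mul (fps_mul f g) h = fps_mul (fps_mul f h) g.
Proof. by rewrite -!fps_mulA [fps_mul g h]fps_mulC. Qed.

Lemma fps_scaleM c f g :
  fps_scale c (fps_mul f g) = fps_mul (fps_scale c f) (fps_scale c g).
Proof.
apply/funext => n; rewrite /fps_scale /fps_mul mulr_sumr.
apply: eq_bigr => i _; have le_in : (i <= n)%N by rewrite -ltnS.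
by rewrite mulrACA -exprD subnKC.
Qed.

Lemma fps_scale_exp (c x : K) : fps_scale c (fps_exp x) = fps_exp (c * x).
Proof. by apply/funext => n; rewrite /fps_scale /fps_exp mulrA -exprMn. Qed.

Lemma fps_mul_trinomial f g h n :
  fps_mul (fps_mul f g) h n =
  \sum_(k < n.+1) \sum_(l < n.+1) \sum_(m < n.+1 | (k + l + m == n)%N)
    f k * g l * h m.
Proof.
rewrite -fps_mulA; apply: eq_bigr => k _; rewrite mulr_sumr.
have le_kn : (k <= n)%N by rewrite -ltnS.
(* The index [l] first runs only up to [n - k]; widening it to [n] adds a guard. Under the guard the
   sole admissible [m] is [n - k - l], and otherwise [k + l] exceeds [n] and the sum over [m] is
   empty. *)
rewrite (big_ord_widen n.+1 (fun l => f k * (g l * h (n - k - l)%N)));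
  last by rewrite ltnS leq_subr.
rewrite [LHS]big_mkcond; apply: eq_bigr => l _; case: ifPn => le_l.
  have lt_m : (n - k - l < n.+1)%N by lia.
  rewrite (big_pred1 (Ordinal lt_m)) ?mulrA// => m.
  by rewrite /= -val_eqE /=; lia.
by rewrite big_pred0 // => m; lia.
Qed.

Section CharacteristicZero.
Hypothesis char0 : forall m, m.+1%:R != 0 :> K.

Lemma fact_neq0 m : m`!%:R != 0 :> K.
Proof. by rewrite -(prednK (fact_gt0 m)). Qed.

Lemma fps_expD (x y : K) : fps_mul (fps_exp x) (fps_exp y) = fps_exp (x + y).
Proof.
(* In [exprDn] the second summand carries the exponent [i], so [addrC] makes it [x], as in the
   convolution. *)
apply/funext => n; rewrite /fps_mul /fps_exp addrC exprDn mulr_suml.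
apply: eq_bigr => i _; have le_in : (i <= n)%N by rewrite -ltnS.
(* Factoring [n!] as a binomial coefficient times two factorials shows at once that all three are
   nonzero. *)
have := fact_neq0 n; rewrite -(bin_fact le_in) 2!natrM !mulf_eq0 !negb_or.
rewrite -[(_ * _) *+ _]mulr_natr => /and3P[C0 i0 ni0].
by field; rewrite C0 i0 ni0.
Qed.

Variables (R : realType) (v : K -> R).

(** The trinomial coefficient gives each Bernoulli value its own factorial as denominator, which
    turns it into a coefficient of a series times an exponential. The powers of the [ci] are
    rescalings of [t]. *)
Lemma trinomial_sum_qBernoulli (Q1 Q2 Q3 c1 c2 c3 x1 x2 x3 : K) n :
  trinomial_sum n (fun k l m =>
    (qBernoulli_poly v Q1 k).[x1] * (qBernoulli_poly v Q2 l).[x2]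
    * (qBernoulli_poly v Q3 m).[x3] * (c1 ^+ k * c2 ^+ l * c3 ^+ m)) =
  n`!%:R * fps_mul
    (fps_mul (fps_mul (fps_scale c1 (qBernoulli_series v Q1))
                      (fps_scale c2 (qBernoulli_series v Q2)))
             (fps_scale c3 (qBernoulli_series v Q3)))
    (fps_exp (c1 * x1 + c2 * x2 + c3 * x3)) n.
Proof.
pose F Q c x := fps_scale c (fps_mul (qBernoulli_series v Q) (fps_exp x)).
transitivity (n`!%:R * fps_mul (fps_mul (F Q1 c1 x1) (F Q2 c2 x2))
                                (F Q3 c3 x3) n).
  rewrite fps_mul_trinomial /trinomial_sum mulr_sumr; apply: eq_bigr => k _.
  rewrite mulr_sumr; apply: eq_bigr => l _; rewrite mulr_sumr.
  apply: eq_bigr => m _; rewrite /F /fps_scale -!qBernoulli_poly_series//.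
  by rewrite !natrM; field; rewrite !fact_neq0.
rewrite /F !fps_scaleM !fps_scale_exp -!fps_expD; congr (_ * _ n).
(* Series and exponentials alternate; three exchanges bring the exponentials to the right. *)
rewrite !fps_mulA (fps_mulAC _ (fps_exp (c1 * x1)) (fps_scale c2 _)).
rewrite (fps_mulAC _ (fps_exp (c2 * x2)) (fps_scale c3 _)).
by rewrite (fps_mulAC _ (fps_exp (c1 * x1)) (fps_scale c3 _)).
Qed.

End CharacteristicZero.
End FormalPowerSeriesTheory.

(** The rationals map into [Cp T] by a composite of field morphisms, which is injective. *)
Lemma Cp_char0 (R : realType) (p : nat) (T : padic_tower R p) (m : nat) :
  m.+1%:R != 0 :> Cp T.
Proof.
have -> : m.+1%:R = Cp_of_Qp (Qp_of_rat T m.+1%:R).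
  by rewrite /Cp_of_Qp !rmorph_nat.
by rewrite /Cp_of_Qp !fmorph_eq0 pnatr_eq0.
Qed.

Theorem theorem4p1 (R : realType) (p : nat) (p_prime : prime p)
    (T : padic_tower R p)
    (q : Cp T) (q_neq1 : q <> 1)
    (q_near1 : Cp_abs T (q - 1) < p%:R `^ (- (1 / (p%:R - 1))))
    (w1 w2 w3 : nat) (w1_gt0 : (0 < w1)%N) (w2_gt0 : (0 < w2)%N)
    (w3_gt0 : (0 < w3)%N)
    (n : nat)
    (y1 y2 y3 : Qp T) (y1_Zp : padic_integers y1) (y2_Zp : padic_integers y2) (y3_Zp : padic_integers y3) :
  let B (k : nat) (Q : Cp T) (x : Qp T) : Cp T :=
    (qBernoulli_poly (Cp_abs T) Q k).[Cp_of_Qp x] in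
  let S1 := trinomial_sum n (fun k l m =>
    B k (q ^+ (w2 * w3)) (w1%:R * y1) * B l (q ^+ (w1 * w3)) (w2%:R * y2)
    * B m (q ^+ (w1 * w2)) (w3%:R * y3)
    * w1%:R ^+ (l + m) * w2%:R ^+ (k + m) * w3%:R ^+ (k + l)) in
  let S2 := trinomial_sum n (fun k l m =>
    B k (q ^+ (w2 * w3)) (w1%:R * y1) * B l (q ^+ (w1 * w2)) (w3%:R * y2)
    * B m (q ^+ (w1 * w3)) (w2%:R * y3)
    * w1%:R ^+ (l + m) * w3%:R ^+ (k + m) * w2%:R ^+ (k + l)) in
  let S3 := trinomial_sum n (fun k l m =>
    B k (q ^+ (w1 * w3)) (w2%:R * y1) * B l (q ^+ (w2 * w3)) (w1%:R * y2)
    * B m (q ^+ (w1 * w2)) (w3%:R * y3)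
    * w2%:R ^+ (l + m) * w1%:R ^+ (k + m) * w3%:R ^+ (k + l)) in
  let S4 := trinomial_sum n (fun k l m =>
    B k (q ^+ (w1 * w3)) (w2%:R * y1) * B l (q ^+ (w1 * w2)) (w3%:R * y2)
    * B m (q ^+ (w2 * w3)) (w1%:R * y3)
    * w2%:R ^+ (l + m) * w3%:R ^+ (k + m) * w1%:R ^+ (k + l)) in
  let S5 := trinomial_sum n (fun k l m =>
    B k (q ^+ (w1 * w2)) (w3%:R * y1) * B l (q ^+ (w2 * w3)) (w1%:R * y2)
    * B m (q ^+ (w1 * w3)) (w2%:R * y3)
    * w3%:R ^+ (l + m) * w1%:R ^+ (k + m) * w2%:R ^+ (k + l)) in
  let S6 := trinomial_sum n (fun k l m =>
    B k (q ^+ (w1 * w2)) (w3%:R * y1) * B l (q ^+ (w1 * w3)) (w2%:R * y2)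
    * B m (q ^+ (w2 * w3)) (w1%:R * y3)
    * w3%:R ^+ (l + m) * w2%:R ^+ (k + m) * w1%:R ^+ (k + l)) in
  [/\ S1 = S2, S2 = S3, S3 = S4, S4 = S5 & S5 = S6].
Proof.
pose G (c : nat) :=
  fps_scale c%:R (qBernoulli_series (Cp_abs T) (q ^+ c)).
pose E : nat -> Cp T := fps_exp
  ((w1 * w2 * w3)%:R * (Cp_of_Qp y1 + Cp_of_Qp y2 + Cp_of_Qp y3)).
pose V (a b c : nat) :=
  n`!%:R * fps_mul (fps_mul (fps_mul (G a) (G b)) (G c)) E n.
(* These two adjacent transpositions generate all permutations of the arguments of [V]. *)
have VC a b c : V a b c = V b a c by rewrite /V [fps_mul (G a) _]fps_mulC.
have VAC a b c : V a b c = V a c b by rewrite /V (fps_mulAC _ (G b)).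
have CpM (w : nat) (y : Qp T) : Cp_of_Qp (w%:R * y) = w%:R * Cp_of_Qp y.
  by rewrite /Cp_of_Qp !rmorphM !rmorph_nat.
(* Here [vi] is the cofactor of [ci] in [w1 * w2 * w3], so the exponent [ci * vi * yi] has the same
   coefficient for every [i], in whatever order the pairs come. *)
have sumE (c1 c2 c3 v1 v2 v3 : nat) F :
    (c1 * v1 = w1 * w2 * w3)%N -> (c2 * v2 = w1 * w2 * w3)%N ->
    (c3 * v3 = w1 * w2 * w3)%N ->
    (forall k l m, F k l m =
      (qBernoulli_poly (Cp_abs T) (q ^+ c1) k).[Cp_of_Qp (v1%:R * y1)]
      * (qBernoulli_poly (Cp_abs T) (q ^+ c2) l).[Cp_of_Qp (v2%:R * y2)]
      * (qBernoulli_poly (Cp_abs T) (q ^+ c3) m).[Cp_of_Qp (v3%:R * y3)]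
      * (c1%:R ^+ k * c2%:R ^+ l * c3%:R ^+ m)) ->
    trinomial_sum n F = V c1 c2 c3.
  move=> e1 e2 e3 FE; transitivity (trinomial_sum n (fun k l m =>
    (qBernoulli_poly (Cp_abs T) (q ^+ c1) k).[Cp_of_Qp (v1%:R * y1)]
    * (qBernoulli_poly (Cp_abs T) (q ^+ c2) l).[Cp_of_Qp (v2%:R * y2)]
    * (qBernoulli_poly (Cp_abs T) (q ^+ c3) m).[Cp_of_Qp (v3%:R * y3)]
    * (c1%:R ^+ k * c2%:R ^+ l * c3%:R ^+ m))).
    by do 3![apply: eq_bigr => ? _]; rewrite FE.
  rewrite trinomial_sum_qBernoulli; last exact: Cp_char0.
  by rewrite !CpM !mulrA -!natrM e1 e2 e3 -!mulrDr.
move=> B S1 S2 S3 S4 S5 S6.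
(* The weights regroup by summation index: [w2] and [w3] occur to the power [k], [w1] and [w3] to
   the power [l], [w1] and [w2] to the power [m]. The other five sums regroup likewise. *)
have E1 : S1 = V (w2 * w3)%N (w1 * w3)%N (w1 * w2)%N.
  apply: (sumE _ _ _ w1 w2 w3) => [|||k l m]; [lia.. |].
  by rewrite /B !natrM !exprMn !exprD; ring.
have E2 : S2 = V (w2 * w3)%N (w1 * w2)%N (w1 * w3)%N.
  apply: (sumE _ _ _ w1 w3 w2) => [|||k l m]; [lia.. |].
  by rewrite /B !natrM !exprMn !exprD; ring.
have E3 : S3 = V (w1 * w3)%N (w2 * w3)%N (w1 * w2)%N.
  apply: (sumE _ _ _ w2 w1 w3) => [|||k l m]; [lia.. |].
  by rewrite /B !natrM !exprMn !exprD; ring.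
have E4 : S4 = V (w1 * w3)%N (w1 * w2)%N (w2 * w3)%N.
  apply: (sumE _ _ _ w2 w3 w1) => [|||k l m]; [lia.. |].
  by rewrite /B !natrM !exprMn !exprD; ring.
have E5 : S5 = V (w1 * w2)%N (w2 * w3)%N (w1 * w3)%N.
  apply: (sumE _ _ _ w3 w1 w2) => [|||k l m]; [lia.. |].
  by rewrite /B !natrM !exprMn !exprD; ring.
have E6 : S6 = V (w1 * w2)%N (w1 * w3)%N (w2 * w3)%N.
  apply: (sumE _ _ _ w3 w2 w1) => [|||k l m]; [lia.. |].
  by rewrite /B !natrM !exprMn !exprD; ring.
rewrite E1 E2 E3 E4 E5 E6; split.
(* The first, third and fifth equalities exchange the last two arguments of [V]; the second and
   fourth are cyclic shifts. *)
- exact: VAC.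
- by rewrite VAC VC.
- exact: VAC.
- by rewrite VAC VC VAC VC VAC.
- exact: VAC.
Qed.
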